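(* Let $q$ be a prime power and $n \geq 1$ an integer. If the graph $\Gamma_{l-i}(M_n(F_q))$ has a cycle, then its girth is $g(\Gamma_{l-i}(M_n(F_q))) = 3$.
   Context: $F_q$ is the finite field with $q$ elements and $M_n(F_q)$ is the ring of all $n\times n$ matrices over $F_q$. For $X \in M_n(F_q)$, $[X] = \{AX : A \in M_n(F_q)\}$ is the left ideal generated by $X$. The undirected left-ideal relation graph $\Gamma_{l-i}(M_n(F_q))$ is the simple graph with vertex set $M_n(F_q)$ in which two distinct vertices $X, Y$ are adjacent if and only if $[X] \subset [Y]$ or $[Y] \subset [X]$, where $\subset$ denotes proper containment. The girth $g(\Gamma)$ is the length of a shortest cycle of $\Gamma$. *)

(* Defs.v *)
From mathcomp Require Import all_boot all_order all_algebra.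

Set Implicit Arguments.
Unset Strict Implicit.
Unset Printing Implicit Defensive.

Local Open Scope ring_scope.

Definition prime_power (q : nat) : Prop :=
  exists p k : nat, [/\ prime p, (0 < k)%N & q = (p ^ k)%N].

(* A simple graph on T is given by its adjacency relation, a symmetric and
   irreflexive e : rel T.  Since [ucycle] also accepts the empty list and
   a single edge traversed back and forth, a length of at least 3 is required
   separately. *)
Definition is_cycle (T : eqType) (e : rel T) (c : seq T) : bool :=
  (2 < size c)%N && ucycleb e c.

Definition has_cycle (T : eqType) (e : rel T) : Prop :=
  exists c : seq T, is_cycle e c.

(* The girth of a graph without cycles is None.  The length of a cycle is at
   most #|T|, so that the search range is exhaustive; see girthP. *)
Definition girth (T : finType) (e : rel T) : option nat :=
  ohead [seq k <- iota 0 #|T|.+1 | [exists c : k.-tuple T, is_cycle e c]].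

Lemma girthP (T : finType) (e : rel T) (g : nat) :
  girth e = Some g <->
  (exists2 c : seq T, is_cycle e c & size c = g) /\
  (forall c : seq T, is_cycle e c -> (g <= size c)%N).
Proof.
rewrite /girth; set P := fun k => [exists c : k.-tuple T, is_cycle e c].
have PE k : P k <-> exists2 c : seq T, is_cycle e c & size c = k.
  split=> [/existsP[c Hc]|[c Hc <-]]; first by exists c; rewrite ?size_tuple.
  by apply/existsP; exists (in_tuple c).
have cycle_size c : is_cycle e c -> (size c < #|T|.+1)%N.
  by move=> /andP[_ /andP[_ Uc]]; rewrite ltnS -(card_uniqP Uc) max_card.
have aux m d : ohead [seq k <- iota m d | P k] = Some g <->
    [/\ P g, (m <= g < m + d)%N & forall k, (m <= k < g)%N -> ~~ P k].
  elim: d m => [|d IHd] m /=.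
    split=> // -[_ /andP[mg]]; by rewrite addn0 ltnNge mg.
  case: ifPn => Pm /=.
    split=> [[<-]|[Pg /andP[mg _] min_g]].
      split=> //; first by rewrite leqnn addnS ltnS leq_addr.
      by move=> k /andP[mk]; rewrite ltnNge mk.
    move: mg; rewrite leq_eqVlt => /predU1P[-> //|mg].
    by have := min_g m; rewrite leqnn mg Pm => /(_ isT).
  apply: (iff_trans (IHd _)); rewrite addSnnS; split=> -[Pg /andP[mg gd] min_g]; split=> //.
  - by rewrite gd (ltnW mg).
  - move=> k /andP[]; rewrite leq_eqVlt => /predU1P[<- //|mk kg].
    by apply: min_g; rewrite mk.
  - rewrite gd andbT ltn_neqAle mg andbT.
    by apply: contraNneq Pm => ->.
  - by move=> k /andP[mk kg]; apply: min_g; rewrite kg (ltnW mk).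
apply: (iff_trans (aux _ _)); rewrite add0n; split=> [[/PE Pg _ min_g]|[Pg min_g]].
  split=> // c Hc; rewrite leqNgt; apply/negP => /(min_g _)/negP; apply.
  by apply/PE; exists c.
split; first exact/PE.
  by case: Pg => c Hc <-; rewrite cycle_size.
move=> k /= kg; apply/negP => /PE[c Hc ck].
by have := min_g c Hc; rewrite ck leqNgt kg.
Qed.

Definition left_ideal (F : finFieldType) (n : nat) (X : 'M[F]_n) :
    {set 'M[F]_n} :=
  [set A *m X | A : 'M[F]_n].

Definition left_ideal_graph (F : finFieldType) (n : nat) : rel 'M[F]_n :=
  fun X Y => (X != Y) &&
    ((left_ideal X \proper left_ideal Y) ||
     (left_ideal Y \proper left_ideal X)).

Arguments left_ideal_graph : clear implicits.

Lemma left_ideal_graph_sym (F : finFieldType) (n : nat) :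
  symmetric (left_ideal_graph F n).
Proof. by move=> X Y; rewrite /left_ideal_graph eq_sym orbC. Qed.

Lemma left_ideal_graph_irr (F : finFieldType) (n : nat) :
  irreflexive (left_ideal_graph F n).
Proof. by move=> X; rewrite /left_ideal_graph eqxx. Qed.

(* Main.v *)
(** Left ideals of the matrix ring correspond to row spaces, so adjacency is
    strict comparability of row spaces.  For [n > 1] the matrices of rank
    [0 < 1 < n] given by [pid_mx] form a triangle; for [n = 1] the graph is a
    star centred at [0], which has no cycle. *)
Require Import Defs.
From mathcomp Require Import all_boot all_order all_algebra.

(** As [X = 1 *m X] lies in its own left ideal, inclusion only needs to be tested on the generator
    [X]. *)
Lemma left_ideal_subset (F : finFieldType) (n : nat) (X Y : 'M[F]_n) :
  (left_ideal X \subset left_ideal Y) = (X <= Y)%MS.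
Proof.
apply/subsetP/submxP => [sXY | [D ->] _ /imsetP[A _ ->]].
  have /sXY/imsetP[D _ ->] : X \in left_ideal X.
    by apply/imsetP; exists 1%:M%R; rewrite ?mul1mx.
  by exists D.
by apply/imsetP; exists (A *m D)%R; rewrite ?mulmxA.
Qed.

Lemma left_ideal_proper (F : finFieldType) (n : nat) (X Y : 'M[F]_n) :
  (left_ideal X \proper left_ideal Y) = (X < Y)%MS.
Proof. by rewrite properE !left_ideal_subset. Qed.

Lemma ltmx_adjacent (F : finFieldType) (n : nat) (X Y : 'M[F]_n) :
  (X < Y)%MS -> left_ideal_graph F n X Y.
Proof.
move=> ltXY; rewrite /left_ideal_graph !left_ideal_proper ltXY andbT.
by apply: contraTneq ltXY => ->; rewrite ltmx_irrefl.
Qed.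

(** Ranks are at most 1 here, so strict inclusion of row spaces leaves only the ranks 0 and 1. *)
Lemma adjacent_dim1 (F : finFieldType) (X Y : 'M[F]_1) :
  left_ideal_graph F 1 X Y -> (X == 0%R) = (Y != 0%R).
Proof.
rewrite /left_ideal_graph !left_ideal_proper -!mxrank_eq0 => /andP[_].
by case/orP=> /rank_ltmx; move: (rank_leq_row X) (rank_leq_row Y);
  case: (\rank X) => [|[|]] //; case: (\rank Y) => [|[|]].
Qed.

Lemma acyclic_dim1 (F : finFieldType) : ~ has_cycle (left_ideal_graph F 1).
Proof.
case=> -[|x [|y [|z s]]] // /andP[_ /andP[/= /and3P[adj_xy adj_yz path_z]]].
have nbr0 u v : left_ideal_graph F 1 u v -> u != 0%R -> v = 0%R.
  by move/adjacent_dim1 => uv u0; apply/eqP; move: uv; rewrite (negPf u0);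
    case: eqP.
(* A nonzero [y] forces both its neighbours [x] and [z] to be 0, a repeated vertex. *)
have [y0 | y0] := eqVneq y 0%R; last first.
  have z0 := nbr0 _ _ adj_yz y0.
  rewrite left_ideal_graph_sym in adj_xy.
  by rewrite z0 (nbr0 _ _ adj_xy y0) !inE eqxx orbT.
have z_n0 : z != 0%R by rewrite -(adjacent_dim1 _ _ _ adj_yz) y0.
(* The successor of [z] on the cycle, [x] if [s] is empty and [w] otherwise, is 0 because [z] is
   not; this repeats [y]. *)
case: s path_z => [|w s] /=.
  by rewrite andbT => /nbr0/(_ z_n0)->; rewrite y0 !inE eqxx.
by case/andP=> /nbr0/(_ z_n0)-> _; rewrite y0 !inE eqxx !orbT andbF.
Qed.

Lemma ltmx_pid (F : fieldType) (n r s : nat) :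
  r < s <= n -> ((pid_mx r : 'M[F]_n) < (pid_mx s : 'M[F]_n))%MS.
Proof.
case/andP=> lt_rs le_sn; have le_rn := leq_trans (ltnW lt_rs) le_sn.
rewrite ltmxErank !rank_pid_mx // lt_rs andbT; apply/submxP.
(* The product of [pid_mx r] and [pid_mx s] is [pid_mx r], as [r < s]. *)
by exists (pid_mx r); rewrite mul_pid_mx (minn_idPl (ltnW lt_rs))
  (minn_idPr le_rn).
Qed.

Theorem theorem4p6 (q n : nat) (hq : prime_power q) (hn : (1 <= n)%N)
    (F : finFieldType) (hF : #|F| = q)
    (hcycle : has_cycle (left_ideal_graph F n)) :
  girth (left_ideal_graph F n) = Some 3%N.
Proof.
case: n hn hcycle => [|[|n]] // _ hcycle; first by case: (acyclic_dim1 _ hcycle).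
(* The lower bound 3 is the length condition in [is_cycle]. *)
apply/girthP; split=> [|c /andP[]//].
(* The existential hides [pid_mx]: only the adjacencies matter below. *)
have [P adjP] : exists P : nat -> 'M[F]_n.+2,
    forall r s, r < s <= n.+2 -> left_ideal_graph F n.+2 (P r) (P s).
  by exists (fun r => pid_mx r) => r s rs; apply/ltmx_adjacent/ltmx_pid.
have neqP r s : r < s <= n.+2 -> P r != P s by move/adjP/andP=> [].
have adj20 : left_ideal_graph F n.+2 (P 2) (P 0).
  by rewrite left_ideal_graph_sym; exact: adjP.
exists [:: P 0; P 1; P 2] => //; apply/andP; split=> //; apply/andP; split.
  exact/and4P/(And4 (adjP 0 1 isT) (adjP 1 2 isT) adj20 isT).
by rewrite /= !inE !negb_or !neqP.
Qed.
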